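(* For every alphabet $\Sigma=\{1,2,\dots,\sigma\}$ there exists an infinite family of strings over $\Sigma$ with the following properties. Each string has length $n=k\sigma$ for some integer $k$. Each string contains $\Omega(\sigma n)$ fragments that are order-preserving squares and that are pairwise distinct as words. The constant hidden in $\Omega$ is absolute.
   Context: Two strings $u,v$ over an ordered alphabet are order-isomorphic, written $u\approx v$, if $|u|=|v|$ and for all $i,j$ we have $u[i]\le u[j]$ iff $v[i]\le v[j]$. An order-preserving square is a string $uv$ with $u\approx v$ and $u\neq v$. Two order-preserving squares are distinct as words if they are different strings.
   Formalization: The alphabet is required to have σ ≥ 2 letters, since over a one-letter alphabet u≈v forces u=v, so there are no order-preserving squares and the Ω(σn) bound fails. *)

(* Defs.v *)
From mathcomp Require Import all_boot all_order all_algebra.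
From mathcomp Require Import classical_sets cardinality.
Set Implicit Arguments.
Unset Strict Implicit.
Unset Printing Implicit Defensive.

Section OrderPreserving.
Context {d : Order.disp_t} {T : orderType d}.
Implicit Types u v w : seq T.

(* The default value x0 is irrelevant, since both indices are in range. *)
Definition order_isomorphic u v : Prop :=
  size u = size v /\
  forall (x0 : T) (i j : nat), i < size u -> j < size u ->
    (nth x0 u i <= nth x0 u j)%O <-> (nth x0 v i <= nth x0 v j)%O.

Definition op_square w : Prop :=
  exists u v, [/\ w = u ++ v, order_isomorphic u v & u <> v].

(* The pair p = (i, j) denotes the fragment of w at the 0-based positions
   i, ..., j - 1. *)
Definition is_fragment w (p : nat * nat) : bool := p.1 <= p.2 <= size w.

Definition fragment w (p : nat * nat) : seq T := take (p.2 - p.1) (drop p.1 w).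

End OrderPreserving.

Definition string_over (sigma : nat) (w : seq nat) : bool :=
  all (fun a => 1 <= a <= sigma) w.

(* Main.v *)
Require Import Defs.
From mathcomp Require Import all_boot all_order all_algebra.
From mathcomp Require Import classical_sets cardinality.
From mathcomp Require Import zify.
Import Order.TTheory GRing.Theory Num.Theory.

(** The family consists of the strings [1^k 2^k ... sigma^k]. Advancing by [k * l]
    positions in such a string adds [l] to the letter, so every fragment of length
    [2 * (k * l)] with [l > 0] is an order-preserving square. Since such a fragment
    is longer than a run, it crosses a run boundary, and its first letter and the
    position of the boundary determine where it starts. There are about
    [sigma / 4] half-lengths [k * l] for a positive fraction of the starting
    positions. For [sigma = 2] this leaves too few starting positions, and the
    squares [1^m 2^m] with [m <= k] are used instead. *)

Definition staircase (k p n : nat) : seq nat :=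
  mkseq (fun i => ((p + i) %/ k).+1) n.

Lemma size_staircase k p n : size (staircase k p n) = n.
Proof. exact: size_mkseq. Qed.

Lemma nth_staircase x0 k p n i :
  i < n -> nth x0 (staircase k p n) i = ((p + i) %/ k).+1.
Proof. exact: nth_mkseq. Qed.

Lemma staircase_cat k p m n :
  staircase k p (m + n) = staircase k p m ++ staircase k (p + m) n.
Proof.
rewrite /staircase /mkseq iotaD map_cat add0n; congr (_ ++ _).
rewrite -[m in LHS]addn0 iotaDl -map_comp; apply: eq_map => i /=.
by rewrite addnA.
Qed.

Lemma string_over_staircase k sigma :
  0 < k -> string_over sigma (staircase k 0 (k * sigma)).
Proof.
move=> k0; apply/allP => a /mapP[i]; rewrite mem_iota /= add0n => ltik ->.
by rewrite add0n ltn_divLR // mulnC.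
Qed.

(** Keeping the start [p] as a parameter of [staircase] makes every fragment of a staircase a
    staircase again. *)
Lemma fragment_staircase k p q n :
  p <= q <= n -> fragment (staircase k 0 n) (p, q) = staircase k p (q - p).
Proof.
move=> /andP[lepq leqn]; rewrite /fragment /=.
have -> : n = (p + (q - p)) + (n - q) by lia.
rewrite !staircase_cat -catA drop_size_cat ?size_staircase //.
by rewrite add0n take_size_cat ?size_staircase.
Qed.

Lemma order_isomorphic_shift (l : nat) (u : seq nat) :
  order_isomorphic u (map (addn l) u).
Proof.
split=> [|x0 i j lti ltj]; first by rewrite size_map.
by rewrite !(nth_map x0) // !leEnat leq_add2l.
Qed.

Lemma op_square_shift (l : nat) (u : seq nat) :
  0 < l -> 0 < size u -> op_square (u ++ map (addn l) u).
Proof.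
move=> l0; case: u => // a u _.
exists (a :: u), (map (addn l) (a :: u)); split=> //.
  exact: order_isomorphic_shift.
(* The two halves differ in their first letters, [a] and [l + a]. *)
by case; lia.
Qed.

Lemma op_square_staircase k l p :
  0 < k -> 0 < l -> op_square (staircase k p (k * l + k * l)).
Proof.
move=> k0 l0; rewrite staircase_cat.
have -> : staircase k (p + k * l) (k * l) =
          map (addn l) (staircase k p (k * l)).
  rewrite /staircase /mkseq -map_comp; apply: eq_map => i /=.
  have -> : p + k * l + i = l * k + (p + i) by lia.
  by rewrite divnMDl // addnS.
by apply: op_square_shift => //; rewrite size_staircase muln_gt0 k0.
Qed.

Lemma staircase_start_inj k n p q :
  0 < k < n -> staircase k p n = staircase k q n -> p = q.
Proof.
move=> /andP[k0 ltkn].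
wlog lepq : p q / p <= q.
  by move=> H E; case/orP: (leq_total p q) => le; [|apply/esym]; apply: H.
move=> E; apply/eqP; rewrite eqn_leq lepq /= leqNgt; apply/negP => ltpq.
have := divn_eq q k; have := ltn_pmod q k0.
set m := q %/ k => ltr Eq.
(* [m.+1 * k] is the first run boundary after [q], at distance at most [k < n]. At this offset the
   window from [q] has entered a new run, while the one from [p < q] is still short of the
   boundary. *)
have ltin : m.+1 * k - q < n by lia.
have := congr1 (fun s => nth 0 s (m.+1 * k - q)) E.
rewrite !nth_staircase // subnKC; last by lia.
rewrite mulnK // => -[Em].
have : (p + (m.+1 * k - q)) %/ k < m.+1 by rewrite ltn_divLR //; lia.
by rewrite Em ltnn.
Qed.

(** The window is centred at the boundary between the first two runs; as [m <= k], each half stays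
    inside one run. *)
Lemma staircase_boundary_square k m :
  0 < m <= k -> op_square (staircase k (k - m) (m + m)).
Proof.
move=> /andP[m0 lemk]; rewrite staircase_cat subnK //.
have -> : staircase k k m = map (addn 1) (staircase k (k - m) m).
  rewrite /staircase /mkseq -map_comp; apply/eq_in_map => i.
  rewrite mem_iota /= add0n => ltim.
  rewrite divnDl ?dvdnn // divnn !divn_small ?addn0 //; lia.
by apply: op_square_shift; rewrite ?size_staircase.
Qed.

Lemma staircase_many_squares k sigma : 0 < k -> 1 < sigma ->
  exists s : seq (nat * nat),
    [/\ forall p, p \in s -> is_fragment (staircase k 0 (k * sigma)) p /\
                  op_square (fragment (staircase k 0 (k * sigma)) p),
        uniq [seq fragment (staircase k 0 (k * sigma)) p | p <- s]
      & sigma * (k * sigma) <= 20 * size s].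
Proof.
move=> k0 sigma1; have [->|sigma2] := eqVneq sigma 2.
  exists [seq (k - m, k + m) | m <- iota 1 k]; split.
  - move=> _ /mapP[m + ->]; rewrite mem_iota => Hm.
    rewrite /is_fragment /= size_staircase fragment_staircase; last by lia.
    have -> : k + m - (k - m) = m + m by lia.
    by split; [lia | apply: staircase_boundary_square; lia].
  - rewrite -map_comp map_inj_in_uniq ?iota_uniq // => m m'.
    rewrite !mem_iota /= => Hm Hm'.
    rewrite !fragment_staircase; [|lia|lia].
    by move/(congr1 size); rewrite !size_staircase; lia.
  - by rewrite size_map size_iota; lia.
(* Rounding [sigma / 4] up gives the first bound below; the second is tight at [sigma = 5] and fails
   at [sigma = 2]. *)
set m := (sigma + 3) %/ 4.
have [m1 m2] : sigma <= 4 * m /\ sigma <= 5 * (sigma - 2 * m).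
  by rewrite /m; lia.
have frag p l : 0 < l <= m -> p < k * (sigma - 2 * m) ->
    p <= p + (k * l + k * l) <= k * sigma.
  move=> /andP[l0 lem] ltp.
  have : k * l <= k * m by rewrite leq_mul2l lem orbT.
  by move: ltp; rewrite mulnBr mulnCA; lia.
(* Starts below [k * (sigma - 2 * m)] leave room even for the longest square, of length
   [2 * (k * m)]. *)
exists [seq (p, p + (k * l + k * l)) | l <- iota 1 m,
                                      p <- iota 0 (k * (sigma - 2 * m))].
split.
- move=> _ /allpairsP[[l p]] /= [+ + ->]; rewrite !mem_iota => Hl Hp.
  rewrite /is_fragment /= size_staircase fragment_staircase ?frag //; try lia.
  by split=> //; rewrite addKn; apply: op_square_staircase; lia.
- rewrite map_allpairs allpairs_uniq ?iota_uniq //.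
  move=> _ _ /allpairsP[[l p]] /= [+ + ->] /allpairsP[[l' p']] /= [+ + ->].
  rewrite !mem_iota => Hl Hp Hl' Hp' /=.
  rewrite !fragment_staircase ?frag //; try lia.
  rewrite !addKn => E.
  have El : l = l'.
    move/(congr1 size): E; rewrite !size_staircase !addnn => /double_inj/eqP.
    by rewrite eqn_pmul2l // => /eqP.
  rewrite El in E *; congr (_, _); apply: staircase_start_inj E.
  have : k * 1 <= k * l' by rewrite leq_mul2l; lia.
  lia.
- rewrite size_allpairs !size_iota.
  (* The constant 20 is the product of the factors 4 and 5 in [m1] and [m2]. *)
  have := leq_mul m1 m2.
  move/(leq_mul (leqnn k)); lia.
Qed.

Theorem theorem4 :
  exists c : rat, (0 < c)%R /\
  forall sigma : nat, 1 < sigma ->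
  exists F : set (seq nat), infinite_set F /\
  forall w : seq nat, F w ->
    [/\ string_over sigma w,
        exists k : nat, size w = k * sigma
      & exists s : seq (nat * nat),
          [/\ forall p, p \in s -> is_fragment w p /\ op_square (fragment w p),
              uniq [seq fragment w p | p <- s]
            & (c * (sigma * size w)%:R <= (size s)%:R)%R]].
Proof.
exists (20%:R^-1)%R; split=> [//|sigma sigma1].
(* The successor keeps runs nonempty. Different [k] give different lengths, so the family is
   infinite. *)
pose f k := staircase k.+1 0 (k.+1 * sigma).
exists (range f); split.
  have inj_f : injective f.
    move=> k k' /(congr1 size); rewrite !size_staircase => /eqP.
    by rewrite eqn_pmul2r ?(ltnW sigma1) // => /eqP[].
  move=> fin; apply: infinite_nat.
  by rewrite -(preimage_range f); apply: (finite_preimage (in2W inj_f)).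
move=> _ [k _ <-]; split; first exact: string_over_staircase.
  by exists k.+1; rewrite size_staircase.
have [s [squares uniq_s large]] := staircase_many_squares k.+1 sigma isT sigma1.
exists s; split=> //.
by rewrite size_staircase mulrC ler_pdivrMr // -natrM ler_nat [leqRHS]mulnC.
Qed.
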